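(* Let $\mathcal{A} = \{10a + 11b : a,b \in \mathbb{Z},\ \gcd(a,b)=1,\ a\geq 1,\ b\geq 2a+1\}$. Then $\mathcal{A}$ is unbounded, and there exists a natural number $M\notin\mathcal{A}$ for which $\{M+m : m\geq 1,\ m\in\mathbb{N}\}\subset \mathcal{A}$; indeed, this number is $M=1674$. That is, $1674\notin\mathcal{A}$ and every integer $n>1674$ belongs to $\mathcal{A}$. *)

(* Defs.v *)
From Stdlib Require Import ZArith.
Open Scope Z_scope.

(* Subsets of Z are predicates Z -> Prop. *)
Definition calA (n : Z) : Prop :=
  exists a b : Z,
    n = 10 * a + 11 * b /\ Z.gcd a b = 1 /\ 1 <= a /\ 2 * a + 1 <= b.

Definition unbounded (S : Z -> Prop) : Prop :=
  forall B : Z, exists n : Z, S n /\ B < Z.abs n.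

Definition last_missing (S : Z -> Prop) (M : nat) : Prop :=
  ~ S (Z.of_nat M) /\
  forall m : nat, (1 <= m)%nat -> S (Z.of_nat M + Z.of_nat m).

(* Main.v *)
Require Import Defs.
From Stdlib Require Import ZArith.
From Stdlib Require Import Znumtheory Zwf Lia List Bool.
Open Scope Z_scope.

(** With [t = a + b], membership of [n] means that some [t] coprime to [n] lies
    strictly between [n/11] and [3n/32], an interval of length [n/352].  Legendre's
    sieve over the primes dividing [30 n] produces such a [t] as soon as
    [n > (352 * 30)^2].  Below that bound one takes [t] prime: [n/t] lies strictly
    between 10 and 11, so [t] cannot divide [n], and a chain of primes with
    consecutive ratios below 33/32 covers every [n >= 6000].  The remaining [n] are
    checked one at a time. *)

(** * Membership as coprimality to [n] in a short interval *)

(** The substitution [a = 11 * t - n], [b = n - 10 * t] inverts [t = a + b]. It is unimodular, so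
    gcds agree; [1 <= a] becomes [n < 11 * t], and [b - 2 * a = 3 * n - 32 * t]. *)
Lemma calA_iff_coprime (n : Z) :
  calA n <-> exists t, n < 11 * t /\ 32 * t < 3 * n /\ Z.gcd t n = 1.
Proof.
  split.
  - intros (a & b & -> & Hg & Ha & Hb). exists (a + b).
    split; [lia|]. split; [lia|].
    replace (10 * a + 11 * b) with (b + 10 * (a + b)) by ring.
    rewrite Z.gcd_add_mult_diag_r, Z.gcd_comm.
    replace (a + b) with (a + 1 * b) by ring.
    now rewrite Z.gcd_add_mult_diag_r, Z.gcd_comm.
  - intros (t & H1 & H2 & Hg). exists (11 * t - n), (n - 10 * t).
    split; [ring|]. split; [|lia].
    replace (11 * t - n) with (t + (-1) * (n - 10 * t)) by ring.
    rewrite Z.gcd_comm, Z.gcd_add_mult_diag_r, Z.gcd_comm.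
    replace (n - 10 * t) with (n + (-10) * t) by ring.
    now rewrite Z.gcd_add_mult_diag_r.
Qed.

(** * Legendre's sieve *)

Definition coprimeb (m t : Z) : bool := Z.gcd t m =? 1.

Fixpoint count_coprime (m : Z) (k : nat) : Z :=
  match k with
  | O => 0
  | S j => count_coprime m j + (if coprimeb m (Z.of_nat k) then 1 else 0)
  end.

Lemma coprimeb_rel_prime (m t : Z) : coprimeb m t = true <-> rel_prime t m.
Proof.
  unfold coprimeb. rewrite Z.eqb_eq. apply Zgcd_1_rel_prime.
Qed.

Lemma rel_prime_mul_iff (t p m : Z) :
  rel_prime t (p * m) <-> rel_prime t p /\ rel_prime t m.
Proof.
  split.
  - intros H. apply rel_prime_sym in H.
    split; apply rel_prime_sym; eapply rel_prime_div; eauto.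
    + exists m; ring.
    + exists p; ring.
  - intros [H1 H2]. now apply rel_prime_mult.
Qed.

Lemma coprimeb_mul (p m t : Z) :
  coprimeb (p * m) t = coprimeb p t && coprimeb m t.
Proof.
  apply eq_true_iff_eq.
  rewrite andb_true_iff, !coprimeb_rel_prime. apply rel_prime_mul_iff.
Qed.

Lemma coprimeb_prime (p t : Z) :
  prime p -> coprimeb p t = negb (t mod p =? 0).
Proof.
  intros Hp. pose proof (prime_ge_2 p Hp).
  apply eq_true_iff_eq. rewrite coprimeb_rel_prime, negb_true_iff, Z.eqb_neq.
  rewrite Z.mod_divide by lia. split.
  - intros H1 H2. apply rel_prime_sym in H1.
    destruct H1 as [_ _ H1]. specialize (H1 p (Z.divide_refl _) H2).
    apply Z.divide_1_r in H1. lia.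
  - intros H1. apply rel_prime_sym, prime_rel_prime; assumption.
Qed.

Lemma count_coprime_ext (m m' : Z) (k : nat) :
  (forall t, coprimeb m t = coprimeb m' t) ->
  count_coprime m k = count_coprime m' k.
Proof. intros H. induction k; cbn; [reflexivity|]. now rewrite IHk, H. Qed.

Lemma succ_div_mod (p k : nat) : (0 < p)%nat ->
  (S k mod p = 0 /\ S k / p = S (k / p))%nat \/
  (S k mod p <> 0 /\ S k / p = k / p)%nat.
Proof.
  intros Hp.
  pose proof (Nat.div_mod_eq k p). pose proof (Nat.mod_upper_bound k p).
  destruct (Nat.eq_dec (S (k mod p)) p) as [E|E].
  - left.
    assert (S k / p = S (k / p))%nat by (symmetry; apply (Nat.div_unique _ _ _ 0); nia).
    split; [|assumption]. symmetry; apply (Nat.mod_unique _ _ (S (k / p))); nia.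
  - right. split.
    + rewrite <- (Nat.mod_unique (S k) p (k / p) (S (k mod p))); nia.
    + symmetry; apply (Nat.div_unique _ _ _ (S (k mod p))); nia.
Qed.

(** Legendre's recursion: the integers up to [k] coprime to [m] that the prime [p] removes are the
    [p * s] with [s <= k / p], and [p * s] is coprime to [m] exactly when [s] is. *)
Lemma count_coprime_mul_prime (p : nat) (m : Z) (k : nat) :
  prime (Z.of_nat p) -> ~ (Z.of_nat p | m) ->
  count_coprime (Z.of_nat p * m) k = count_coprime m k - count_coprime m (k / p).
Proof.
  intros Hp Hm. pose proof (prime_ge_2 _ Hp).
  induction k as [|k IH].
  - now rewrite Nat.Div0.div_0_l.
  - cbn [count_coprime].
    rewrite IH, coprimeb_mul, (coprimeb_prime _ _ Hp), <- Nat2Z.inj_mod.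
    destruct (succ_div_mod p k) as [[E1 E2]|[E1 E2]]; [lia| |]; rewrite E2.
    + rewrite E1. cbn [count_coprime].
      assert (coprimeb m (Z.of_nat (S k)) = coprimeb m (Z.of_nat (S (k / p)))) as ->.
      { assert (Z.of_nat (S k) = Z.of_nat p * Z.of_nat (S (k / p))) as ->.
        { pose proof (Nat.div_mod_eq (S k) p). rewrite E1, E2 in H0. lia. }
        apply eq_true_iff_eq. rewrite !coprimeb_rel_prime.
        split; intros H1; apply rel_prime_sym in H1; apply rel_prime_sym.
        - now apply rel_prime_mul_iff in H1.
        - apply rel_prime_mul_iff. split; [|assumption].
          apply rel_prime_sym, prime_rel_prime; assumption. }
      cbn. lia.
    + destruct (Z.eqb_spec (Z.of_nat (S k mod p)) 0); [lia|]. cbn [negb andb]. lia.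
Qed.

Lemma count_coprime_lt (m : Z) (x y : nat) :
  count_coprime m x < count_coprime m y -> (x <= y)%nat ->
  exists t : nat, (x < t <= y)%nat /\ Z.gcd (Z.of_nat t) m = 1.
Proof.
  intros H Hxy. induction Hxy as [|y Hxy IH]; [lia|].
  cbn [count_coprime] in H.
  destruct (coprimeb m (Z.of_nat (S y))) eqn:E.
  - exists (S y). split; [lia|]. now apply Z.eqb_eq.
  - destruct IH as (t & Ht & Hg); [lia|]. exists t. split; [lia|assumption].
Qed.

(* The integers coprime to [m] have density [f / r], with discrepancy at most
   [e - 1] on every interval; each sieving prime doubles [e]. *)
Definition sieve_bound (m e r f : Z) : Prop :=
  1 <= e /\ 0 < f <= r /\
  forall x y : nat, (x <= y)%nat ->
    Z.abs (r * (count_coprime m y - count_coprime m x)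
           - f * (Z.of_nat y - Z.of_nat x)) <= r * (e - 1).

Lemma sieve_bound_1 : sieve_bound 1 1 1 1.
Proof.
  assert (H : forall k, count_coprime 1 k = Z.of_nat k).
  { induction k; [reflexivity|]. cbn [count_coprime]. unfold coprimeb.
    rewrite IHk, Z.gcd_1_r. cbn [Z.eqb Pos.eqb]. lia. }
  split; [lia|]. split; [lia|]. intros x y Hxy. rewrite !H. lia.
Qed.

(** Legendre's recursion uses the old bound twice, on [(x, y]] and on [(x / p, y / p]]. Rounding the
    latter endpoints costs at most 1 more, so the discrepancy becomes
    [2 * (e - 1) + 1 = 2 * e - 1]. *)
Lemma sieve_bound_mul_prime (p m e r f : Z) :
  prime p -> ~ (p | m) -> sieve_bound m e r f ->
  sieve_bound (p * m) (2 * e) (p * r) ((p - 1) * f).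
Proof.
  intros Hp Hm (He & Hf & H). pose proof (prime_ge_2 p Hp) as Hp2.
  split; [lia|]. split; [nia|]. intros x y Hxy.
  rewrite <- (Z2Nat.id p) in Hp, Hm |- * by lia.
  set (q := Z.to_nat p) in *.
  rewrite !count_coprime_mul_prime by assumption.
  assert (Hq : (2 <= q)%nat) by lia.
  pose proof (H x y Hxy) as H1.
  pose proof (H (x / q) (y / q) (Nat.Div0.div_le_mono _ _ _ Hxy))%nat as H2.
  pose proof (Nat.div_mod_eq x q) as Dx. pose proof (Nat.mod_upper_bound x q).
  pose proof (Nat.div_mod_eq y q) as Dy. pose proof (Nat.mod_upper_bound y q).
  set (u := Z.of_nat (x / q)) in *. set (v := Z.of_nat (y / q)) in *.
  set (Cx := count_coprime m (x / q)) in *. set (Cy := count_coprime m (y / q)) in *.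
  set (Q := Z.of_nat q) in *.
  set (X := Z.of_nat x) in *. set (Y := Z.of_nat y) in *.
  set (A := count_coprime m y - count_coprime m x) in *.
  (* The quantity is [x mod q - y mod q], a difference of two remainders. *)
  assert (D : Z.abs (Q * (v - u) - (Y - X)) <= Q).
  { assert (X = Q * u + Z.of_nat (x mod q)) by (subst X Q u; lia).
    assert (Y = Q * v + Z.of_nat (y mod q)) by (subst Y Q v; lia).
    lia. }
  replace (Q * r * (count_coprime m y - Cy - (count_coprime m x - Cx))
           - (Q - 1) * f * (Y - X))
    with (Q * (r * A - f * (Y - X)) - Q * (r * (Cy - Cx) - f * (v - u))
          - f * (Q * (v - u) - (Y - X))) by (subst A; ring).
  assert (0 < Q) by lia.
  set (a := r * A - f * (Y - X)) in *.
  set (b := r * (Cy - Cx) - f * (v - u)) in *.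
  set (c := Q * (v - u) - (Y - X)) in *.
  clearbody a b c.
  assert (Z.abs (Q * a) <= Q * (r * (e - 1)))
    by (rewrite Z.abs_mul; apply Z.mul_le_mono_nonneg; lia).
  assert (Z.abs (Q * b) <= Q * (r * (e - 1)))
    by (rewrite Z.abs_mul; apply Z.mul_le_mono_nonneg; lia).
  (* The rounding error is absorbed because the density [f / r] is at most 1. *)
  assert (Z.abs (f * c) <= r * Q)
    by (rewrite Z.abs_mul; apply Z.mul_le_mono_nonneg; lia).
  replace (Q * r * (2 * e - 1))
    with (Q * (r * (e - 1)) + Q * (r * (e - 1)) + r * Q) by ring.
  lia.
Qed.

Lemma sieve_bound_30 : sieve_bound 30 8 30 8.
Proof.
  assert (H5 : prime 5).
  { apply prime_alt. split; [lia|]. intros k Hk [c Hc].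
    assert (k = 2 \/ k = 3 \/ k = 4) by lia. lia. }
  assert (N : forall p m, 1 < p -> m mod p <> 0 -> ~ (p | m)).
  { intros p m Hp Hm HD. apply Hm, Z.mod_divide; [lia|assumption]. }
  change (sieve_bound (5 * (3 * (2 * 1))) (2 * (2 * (2 * 1)))
            (5 * (3 * (2 * 1))) ((5 - 1) * ((3 - 1) * ((2 - 1) * 1)))).
  repeat apply sieve_bound_mul_prime; auto using prime_2, prime_3, sieve_bound_1;
    apply N; cbn; lia.
Qed.

(** A repeated factor leaves the set of coprime integers unchanged, so it costs nothing. *)
Lemma sieve_bound_dup_prime (p m e r f : Z) :
  (p | m) -> sieve_bound m e r f -> sieve_bound (p * m) e r f.
Proof.
  intros Hpm (He & Hf & H). split; [assumption|]. split; [assumption|].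
  intros x y Hxy.
  rewrite !(count_coprime_ext (p * m) m); [now apply H|..];
  intros t; apply eq_true_iff_eq; rewrite !coprimeb_rel_prime, rel_prime_mul_iff;
  (split; [tauto|]); intros Ht; split; try assumption;
  apply rel_prime_sym; apply rel_prime_sym in Ht; eapply rel_prime_div; eauto.
Qed.

Lemma exists_prime_divisor (n : Z) : 1 < n -> exists p, prime p /\ (p | n).
Proof.
  induction n as [n IH] using (well_founded_induction (Zwf_well_founded 0)).
  intros Hn. destruct (prime_dec n) as [Hp|Hp].
  - exists n. split; [assumption|apply Z.divide_refl].
  - destruct (not_prime_divide n Hn Hp) as (d & Hd & Hdn).
    destruct (IH d) as (p & Hp' & Hpd); [split; lia|lia|].
    exists p. split; [assumption|]. now transitivity d.
Qed.

(* Sieving by 2, 3 and 5 in any case leaves only primes [p >= 7], for which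
   [4 p <= (p - 1)^2]; this is what preserves the last inequality. *)
Lemma sieve_bound_exists (n : Z) : 1 <= n ->
  exists e r f, sieve_bound (30 * n) e r f /\ (e * r) ^ 2 <= 900 * f ^ 2 * n.
Proof.
  induction n as [n IH] using (well_founded_induction (Zwf_well_founded 0)).
  intros Hn. destruct (Z.eq_dec n 1) as [->|Hn1].
  (* Equality holds here, [(8 * 30) ^ 2 = 900 * 8 ^ 2], whence the constant 900. *)
  - exists 8, 30, 8. split; [exact sieve_bound_30|lia].
  - destruct (exists_prime_divisor n) as (p & Hp & m & Hm); [lia|].
    pose proof (prime_ge_2 p Hp) as Hp2.
    destruct (IH m) as (e & r & f & HS & HB); [split; nia|nia|].
    assert (Hm1 : 1 <= m) by nia.
    replace (30 * n) with (p * (30 * m)) by lia.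
    destruct (Zdivide_dec p (30 * m)) as [HD|HD].
    + exists e, r, f. split; [now apply sieve_bound_dup_prime|].
      assert (0 <= f ^ 2) by nia. nia.
    + exists (2 * e), (p * r), ((p - 1) * f).
      split; [now apply sieve_bound_mul_prime|].
      assert (H30 : forall c, 30 = c * p -> False).
      { intros c Hc. apply HD. exists (c * m). rewrite Hc. ring. }
      assert (Hp7 : 7 <= p).
      (* These cofactors of 30 exclude [p] = 2, 3, 5 and 6; only 4 needs its own argument. *)
      { pose proof (H30 15). pose proof (H30 10). pose proof (H30 6).
        pose proof (H30 5).
        assert (p <> 4).
        { intros ->. apply prime_alt in Hp. destruct Hp as [_ Hp].
          apply (Hp 2); [lia|]. now exists 2. }
        lia. }
      assert (HP : 4 * p <= (p - 1) ^ 2) by nia.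
      replace ((2 * e * (p * r)) ^ 2) with (4 * p ^ 2 * (e * r) ^ 2) by ring.
      replace (900 * ((p - 1) * f) ^ 2 * n)
        with (p * ((p - 1) ^ 2 * (900 * f ^ 2 * m))) by (subst n; ring).
      assert (0 <= (e * r) ^ 2) by nia.
      assert (4 * p * (e * r) ^ 2 <= (p - 1) ^ 2 * (900 * f ^ 2 * m))
        by (apply Z.mul_le_mono_nonneg; lia).
      replace (4 * p ^ 2 * (e * r) ^ 2) with (p * (4 * p * (e * r) ^ 2)) by ring.
      apply Z.mul_le_mono_nonneg_l; lia.
Qed.

Lemma calA_large (n : Z) : 111513600 < n -> calA n.
Proof.
  intros Hn. apply calA_iff_coprime.
  destruct (sieve_bound_exists n) as (e & r & f & (He & Hf & HS) & HB); [lia|].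
  (* Compare squares: [(352 * e * r) ^ 2 <= 352 ^ 2 * 900 * f ^ 2 * n], and
     [352 ^ 2 * 900 = 111513600 < n]. *)
  assert (HE : 352 * (e * r) < f * n).
  { apply Z.nle_gt. intros HC.
    assert (0 < f * n) by nia.
    assert ((f * n) ^ 2 <= (352 * (e * r)) ^ 2) by (apply Z.pow_le_mono_l; lia).
    replace ((352 * (e * r)) ^ 2) with (123904 * (e * r) ^ 2) in * by ring.
    assert ((f * n) ^ 2 <= (f ^ 2 * n) * 111513600) by lia.
    replace ((f * n) ^ 2) with ((f ^ 2 * n) * n) in * by ring.
    assert (0 < f ^ 2 * n) by nia.
    nia. }
  (* The admissible [t] are exactly those with [x < t <= y]. *)
  set (x := n / 11). set (y := (3 * n - 1) / 32).
  assert (Hx : 11 * x <= n < 11 * x + 11)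
    by (pose proof (Z.div_mod n 11); pose proof (Z.mod_pos_bound n 11); lia).
  assert (Hy : 32 * y <= 3 * n - 1 < 32 * y + 32)
    by (pose proof (Z.div_mod (3 * n - 1) 32);
        pose proof (Z.mod_pos_bound (3 * n - 1) 32); lia).
  assert (HL : n <= 352 * (y - x + 1)) by lia.
  assert (Hxy : (Z.to_nat x <= Z.to_nat y)%nat) by lia.
  specialize (HS _ _ Hxy). rewrite !Z2Nat.id in HS by lia.
  destruct (count_coprime_lt (30 * n) (Z.to_nat x) (Z.to_nat y)) as (t & Ht & Hg).
  - assert (f * n <= f * (352 * (y - x + 1))) by (apply Z.mul_le_mono_nonneg_l; lia).
    assert (e * r < f * (y - x + 1)) by lia.
    (* [r] times the count is at least [f * (y - x) - r * (e - 1)], which exceeds [r - f >= 0]. *)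
    apply Z.lt_0_sub, (Z.mul_pos_cancel_l r); lia.
  - exact Hxy.
  - exists (Z.of_nat t). split; [lia|]. split; [lia|].
    apply Zgcd_1_rel_prime. apply Zgcd_1_rel_prime in Hg.
    now apply rel_prime_mul_iff in Hg.
Qed.

(** * Finite verification *)

(** Trial division; exhausted fuel answers [false], so only [true] carries information. *)
Fixpoint no_divisor_from (fuel : nat) (d p : Z) : bool :=
  match fuel with
  | O => false
  | S k => if p <? d * d then true
           else if p mod d =? 0 then false
           else no_divisor_from k (d + 1) p
  end.

Lemma no_divisor_from_sound (fuel : nat) (d p : Z) :
  0 < d -> no_divisor_from fuel d p = true ->
  forall q, d <= q -> q * q <= p -> ~ (q | p).
Proof.
  revert d. induction fuel as [|k IH]; cbn; intros d Hd H q Hq Hqp HD; [discriminate|].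
  destruct (Z.ltb_spec p (d * d)); [nia|].
  destruct (Z.eqb_spec (p mod d) 0) as [E|E]; [discriminate|].
  destruct (Z.eq_dec q d) as [->|Hne].
  - apply E, Z.mod_divide; [lia|assumption].
  - apply (IH (d + 1) ltac:(lia) H q); [lia|assumption|assumption].
Qed.

(** If the gcd [g] were not 1, its cofactor [h] in [p] would not be 1 either, as [p] does not divide
    [n]; the smaller of [g] and [h] would then be a forbidden divisor. *)
Lemma gcd_1_of_no_divisor (p n : Z) :
  2 <= p -> (forall q, 2 <= q -> q * q <= p -> ~ (q | p)) -> ~ (p | n) ->
  Z.gcd p n = 1.
Proof.
  intros Hp H Hn.
  destruct (Z.gcd_divide_l p n) as [h Hh].
  pose proof (Z.gcd_nonneg p n). pose proof (Z.gcd_divide_r p n) as Hr.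
  set (g := Z.gcd p n) in *.
  destruct (Z.eq_dec g 1) as [|Hg1]; [assumption|exfalso].
  assert (g <> 0) by (intros E; rewrite E, Z.mul_0_r in Hh; lia).
  assert (h <> 1) by (intros ->; rewrite Z.mul_1_l in Hh; congruence).
  assert (0 < h) by (apply (Z.mul_pos_cancel_r h g); lia).
  destruct (Z.le_ge_cases g h).
  - apply (H g); [lia| |now exists h].
    rewrite Hh. apply Z.mul_le_mono_nonneg_r; lia.
  - apply (H h); [lia| |].
    { rewrite Hh. apply Z.mul_le_mono_nonneg_l; lia. } exists g. lia.
Qed.

(* [N] is the least number not covered so far; [t] runs downwards to the next prime
   and the step succeeds if that prime is still above [N / 11]. *)
Fixpoint prime_chain (fuel : nat) (target N t : Z) : bool :=
  match fuel with
  | O => false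
  | S k =>
      if target <=? N then true
      else if N <? 11 * t then
        if no_divisor_from 4000 2 t
        then prime_chain k target (11 * t) ((33 * t - 1) / 32)
        else prime_chain k target N (t - 1)
      else false
  end.

(** A prime [t] found by the search serves all [n] with [N <= n < 11 * t]; the search then resumes
    from the largest [t] admissible for [11 * t]. *)
Lemma prime_chain_sound (fuel : nat) (target N t : Z) :
  22 <= N -> 32 * t < 3 * N -> prime_chain fuel target N t = true ->
  forall n, N <= n < target -> calA n.
Proof.
  revert N t. induction fuel as [|k IH]; intros N t HN Ht H n Hn; [discriminate|].
  cbn [prime_chain] in H.
  destruct (Z.leb_spec target N); [lia|].
  destruct (Z.ltb_spec N (11 * t)); [|discriminate].
  destruct (no_divisor_from 4000 2 t) eqn:E.
  - destruct (Z.lt_ge_cases n (11 * t)) as [Hlt|Hge].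
    + apply calA_iff_coprime. exists t. split; [lia|]. split; [lia|].
      apply gcd_1_of_no_divisor; [lia| |].
      * exact (no_divisor_from_sound _ 2 t eq_refl E).
      (* No integer quotient fits strictly between 10 and 11. *)
      * intros [c Hc]. assert (10 < c) by (apply (Z.mul_lt_mono_pos_r t); lia).
        assert (c < 11) by (apply (Z.mul_lt_mono_pos_r t); lia). lia.
    + apply (IH (11 * t) ((33 * t - 1) / 32)); [lia| |exact H|lia].
      pose proof (Z.mul_div_le (33 * t - 1) 32). lia.
  - apply (IH N (t - 1)); [lia|lia|exact H|lia].
Qed.

Definition calA_witnessb (n t : Z) : bool :=
  (n <? 11 * t) && (32 * t <? 3 * n) && (Z.gcd t n =? 1).

(** Candidates descend from the largest [t] with [32 * t < 3 * n]. For [n < 6000] the interval is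
    shorter than 18, so twenty exhaust it. *)
Definition calA_checkb (n : Z) : bool :=
  existsb (fun i => calA_witnessb n ((3 * n - 1) / 32 - Z.of_nat i)) (seq 0 20).

Lemma calA_checkb_sound (n : Z) : calA_checkb n = true -> calA n.
Proof.
  intros H. apply existsb_exists in H. destruct H as (i & _ & H).
  unfold calA_witnessb in H. rewrite !andb_true_iff in H.
  rewrite !Z.ltb_lt, Z.eqb_eq in H.
  apply calA_iff_coprime. eexists. split; [apply H|]. split; apply H.
Qed.

Lemma calA_small (n : Z) : 1674 < n < 6000 -> calA n.
Proof.
  assert (H : forallb (fun i => calA_checkb (1675 + Z.of_nat i)) (seq 0 4325) = true)
    by (vm_compute; reflexivity).
  rewrite forallb_forall in H. intros Hn.
  replace n with (1675 + Z.of_nat (Z.to_nat (n - 1675))) by lia.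
  apply calA_checkb_sound, H, in_seq. lia.
Qed.

Lemma calA_medium (n : Z) : 6000 <= n < 111513601 -> calA n.
Proof.
  (* 562 is the largest [t] with [32 * t < 3 * 6000]. Every [t] tested is below [3234 ^ 2], within
     reach of the 4000 trial divisions. *)
  apply (prime_chain_sound 20000 _ 6000 562); [lia|lia|].
  vm_compute. reflexivity.
Qed.

(** * The last missing number *)

Lemma calA_gt_1674 (n : Z) : 1674 < n -> calA n.
Proof.
  intros Hn. destruct (Z.lt_ge_cases n 6000); [apply calA_small; lia|].
  destruct (Z.lt_ge_cases n 111513601); [apply calA_medium; lia|].
  apply calA_large; lia.
Qed.

Lemma not_calA_1674 : ~ calA 1674.
Proof.
  intros H. apply calA_iff_coprime in H. destruct H as (t & H1 & H2 & Hg).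
  (* As [1674 = 2 * 3 ^ 3 * 31], these share with it the primes 3, 2, 31 and 2 respectively. *)
  assert (t = 153 \/ t = 154 \/ t = 155 \/ t = 156) as [->|[->|[->| ->]]] by lia;
    discriminate Hg.
Qed.

(** A smaller [M] would force 1674 into [calA]; a larger one lies in [calA] itself. *)
Lemma last_missing_calA_iff (M : nat) : last_missing calA M <-> Z.of_nat M = 1674.
Proof.
  split.
  - intros [H1 H2].
    destruct (Z.lt_trichotomy (Z.of_nat M) 1674) as [H|[H|H]]; [|assumption|].
    + exfalso. apply not_calA_1674.
      replace 1674 with (Z.of_nat M + Z.of_nat (Z.to_nat (1674 - Z.of_nat M))) by lia.
      apply H2. lia.
    + exfalso. apply H1, calA_gt_1674, H.
  - intros HM. split; rewrite HM.
    + exact not_calA_1674.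
    + intros m Hm. apply calA_gt_1674. lia.
Qed.

Theorem mainTheorem1 :
  unbounded calA /\
  (exists M : nat, last_missing calA M) /\
  (forall M : nat, last_missing calA M <-> Z.of_nat M = 1674) /\
  ~ calA 1674 /\
  (forall n : Z, 1674 < n -> calA n).
Proof.
  repeat split.
  - intros B. exists (Z.abs B + 1675). split; [apply calA_gt_1674|]; lia.
  - exists (Z.to_nat 1674). apply last_missing_calA_iff. now rewrite Z2Nat.id.
  - apply last_missing_calA_iff.
  - now apply last_missing_calA_iff.
  - now apply last_missing_calA_iff.
  - exact not_calA_1674.
  - exact calA_gt_1674.
Qed.
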